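(* Let $p$ be the number of workers, let $h^1,\dots,h^p$ be their loss energies, put $h'^i=h^i/\sum_{j=1}^p h^j$, and for $\tilde a\in\mathbb{R}$ let the normalized weight of worker $i$ be $$\theta^i=\frac{e^{-\tilde a h'^i}}{\sum_{k=1}^p e^{-\tilde a h'^k}},\qquad i=1,\dots,p .$$ If $\tilde a\to\infty$, the weighting strategy is equivalent to broadcasting the best performance case, i.e. the weight of the worker with the best performance (smallest loss energy) tends to $1$ and the weight of every other worker tends to $0$; while if $\tilde a\to 0$, the weighting strategy is equivalent to the equally weighted case, i.e. $\theta^i\to\frac1p$ for every $i$.
   Context: In a parallel stochastic gradient descent scheme, each of $p$ workers $i$ has a parameter vector $x^i$ and a loss energy $h^i$ (smaller is better). When the workers communicate, their parameters are aggregated as $\sum_{i=1}^p\theta^i x^i$. ''Broadcasting the best performance case'' means that the best-performing worker alone determines the communication result (weight $1$ for it, weight $0$ for the others). ''Equally weighted'' means $\theta^i=1/p$ for all $i$.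
   Formalization: For the limit ã→∞ the total loss energy is assumed positive (with a negative total, e.g. h=(-1,-2), the largest loss wins) and the best worker is assumed unique (with ties the weight is shared); the total is assumed nonzero throughout. *)

(* Defs.v *)
From mathcomp Require Import all_boot all_order all_algebra.
From mathcomp Require Import all_classical all_reals all_analysis.

Set Implicit Arguments.
Unset Strict Implicit.
Unset Printing Implicit Defensive.

Import Order.TTheory GRing.Theory Num.Theory.
Import numFieldNormedType.Exports.

Local Open Scope ring_scope.

(* Since [x / 0 = 0] here, this is the intended quantity only when the total
   energy is nonzero. *)
Definition normalized_energy (R : realType) (p : nat) (h : 'I_p -> R)
    (i : 'I_p) : R :=
  h i / \sum_(j < p) h j.

Definition worker_weight (R : realType) (p : nat) (h : 'I_p -> R) (a : R)
    (i : 'I_p) : R :=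
  expR (- a * normalized_energy h i) /
  \sum_(k < p) expR (- a * normalized_energy h k).

(* [b] is the best-performing worker: its energy is strictly smaller than all
   others.  Strictness is what makes "the best worker" well defined; with ties
   the limiting weight would be shared among the minimizers. *)
Definition best_worker (R : realType) (p : nat) (h : 'I_p -> R)
    (b : 'I_p) : Prop :=
  forall j : 'I_p, j != b -> h b < h j.

(* Main.v *)
Require Import Defs.
From mathcomp Require Import all_boot all_order all_algebra.
From mathcomp Require Import all_classical all_reals all_analysis.

Import Order.TTheory GRing.Theory Num.Theory.
Import numFieldNormedType.Exports.

Local Open Scope classical_set_scope.
Local Open Scope ring_scope.

(** Dividing through by its own numerator, the weight of worker [i] is the
    inverse of [\sum_k exp (a (h'_i - h'_k))], a finite sum each of whose terms
    has an obvious limit.  For a worker [j] other than the best one [b] the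
    weight is at most [exp (- a (h'_j - h'_b))], keeping only the term [k = b]. *)

Lemma worker_weightE (R : realType) (p : nat) (h : 'I_p -> R) (a : R)
    (i : 'I_p) :
  worker_weight h a i =
  (\sum_(k < p)
    expR (a * (normalized_energy h i - normalized_energy h k)))^-1.
Proof.
rewrite /worker_weight -[LHS]invrK invf_div mulr_suml; congr (_^-1).
apply: eq_bigr => k _.
by rewrite -expRN -expRD; congr expR; rewrite !mulNr opprK mulrBr addrC.
Qed.

Lemma worker_weight_ge0 (R : realType) (p : nat) (h : 'I_p -> R) (a : R)
    (i : 'I_p) :
  0 <= worker_weight h a i.
Proof. by rewrite divr_ge0 ?expR_ge0// sumr_ge0// => k _; exact: expR_ge0. Qed.

Lemma worker_weight_le_expR (R : realType) (p : nat) (h : 'I_p -> R) (a : R)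
    (i k : 'I_p) :
  worker_weight h a i <=
  expR (- ((normalized_energy h i - normalized_energy h k) * a)).
Proof.
have term_le : expR (a * (normalized_energy h i - normalized_energy h k)) <=
    \sum_(l < p) expR (a * (normalized_energy h i - normalized_energy h l)).
  by rewrite (bigD1 k)//= lerDl sumr_ge0// => l _; exact: expR_ge0.
(* Both sides are now inverses, so the bound is [term_le] reversed; the full sum is positive because
   it dominates a positive term. *)
rewrite worker_weightE expRN [_ * a]mulrC lef_pV2// posrE ?expR_gt0//.
exact: lt_le_trans (expR_gt0 _) term_le.
Qed.

Lemma cvg_expRNM_pinfty (R : realType) (c : R) :
  0 < c -> expR (- (c * a)) @[a --> +oo] --> (0 : R).
Proof.
move=> c_gt0; apply: (cvg_comp (fun a : R => c * a) (fun y => expR (- y))).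
  exact: gt0_cvgMry c_gt0 cvg_id.
exact: cvgr_expR.
Qed.

(** The filter is arbitrary so that the same lemma serves both limits, at [+oo] and at [0]. *)
Lemma cvg_finite_sum (R : realType) (T : Type) (F : set_system T) (p : nat)
    (f : 'I_p -> T -> R) (l : 'I_p -> R) :
  Filter F -> (forall k, f k x @[x --> F] --> l k) ->
  \sum_(k < p) f k x @[x --> F] --> \sum_(k < p) l k.
Proof.
by move=> FF fl; apply: cvg_big => [|k _]; [exact: add_continuous|exact: fl].
Qed.

(** This is where the sign of the total energy matters: dividing by a negative total would reverse
    the order and favour the largest energy. *)
Lemma normalized_energy_lt (R : realType) (p : nat) (h : 'I_p -> R)
    (b j : 'I_p) :
  0 < \sum_(k < p) h k -> best_worker h b -> j != b ->
  normalized_energy h b < normalized_energy h j.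
Proof. by move=> h_gt0 bP jb; rewrite ltr_pM2r ?invr_gt0//; exact: bP. Qed.

Lemma worker_weight_best_cvg (R : realType) (p : nat) (h : 'I_p -> R)
    (b : 'I_p) :
  0 < \sum_(j < p) h j -> best_worker h b ->
  worker_weight h a b @[a --> +oo] --> (1 : R).
Proof.
move=> h_gt0 bP; under eq_fun do rewrite worker_weightE.
rewrite -[X in nbhs X]invr1; apply: cvgV; first exact: oner_neq0.
(* Termwise limits: the term [k = b] is constantly 1, and every other term decays because its
   exponent is [a] times a negative gap. *)
have -> : (1 : R) = \sum_(k < p) (k == b)%:R.
  by rewrite (bigD1 b)//= eqxx big1 ?addr0// => k /negPf ->.
apply: cvg_finite_sum => k; have [->|kb] := eqVneq k b.
  by under eq_fun do rewrite subrr mulr0 expR0; exact: cvg_cst.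
under eq_fun do rewrite -opprB mulrN mulrC.
by apply: cvg_expRNM_pinfty; rewrite subr_gt0 normalized_energy_lt.
Qed.

Lemma worker_weight_other_cvg (R : realType) (p : nat) (h : 'I_p -> R)
    (b j : 'I_p) :
  0 < \sum_(k < p) h k -> best_worker h b -> j != b ->
  worker_weight h a j @[a --> +oo] --> (0 : R).
Proof.
move=> h_gt0 bP jb; apply: squeeze_cvgr; last 2 first.
- exact: cvg_cst.
- apply: (@cvg_expRNM_pinfty _ (normalized_energy h j - normalized_energy h b)).
  by rewrite subr_gt0 normalized_energy_lt.
- by apply: nearW => a; rewrite worker_weight_ge0 worker_weight_le_expR.
Qed.

Lemma worker_weight_cvg0 (R : realType) (p : nat) (h : 'I_p -> R) (i : 'I_p) :
  worker_weight h a i @[a --> (0 : R)] --> (p%:R^-1 : R).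
Proof.
under eq_fun do rewrite worker_weightE.
(* The limit [p] is invertible since the worker [i] itself witnesses [0 < p]. *)
apply: cvgV; first by rewrite pnatr_eq0 -lt0n (leq_ltn_trans _ (ltn_ord i)).
have -> : (p%:R : R) = \sum_(k < p) 1 by rewrite sumr_const card_ord.
apply: cvg_finite_sum => k.
set c := normalized_energy h i - _.
(* Exhibits 1 as the value at [a = 0] of the continuous map [a] to [expR (a * c)]. *)
have -> : (1 : R) = expR (0 * c) by rewrite mul0r expR0.
apply: continuous_cvg; first exact: continuous_expR.
by apply: cvgMr_tmp; exact: cvg_id.
Qed.

Theorem mainTheorem1 (R : realType) (p : nat) (h : 'I_p -> R)
    (h_sum_neq0 : \sum_(j < p) h j != 0) :
  (0 < \sum_(j < p) h j ->
   forall b : 'I_p, best_worker h b ->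
     worker_weight h a b @[a --> +oo] --> (1 : R) /\
     forall j : 'I_p, j != b -> worker_weight h a j @[a --> +oo] --> (0 : R)) /\
  (forall i : 'I_p, worker_weight h a i @[a --> (0 : R)] --> (p%:R^-1 : R)).
Proof.
split=> [h_gt0 b bP|i]; last exact: worker_weight_cvg0.
split=> [|j jb]; first exact: worker_weight_best_cvg.
exact: worker_weight_other_cvg bP jb.
Qed.
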